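(* There exists an absolute constant $K>0$ such that for every sequence $\psi=(\psi(k))_{k\ge 1}$ of nonnegative real numbers with $\sum_{k=1}^{\infty}k\,\psi(k)<\infty$, every $\beta\in\mathbb{R}$ and every $n\in\mathbb{N}$, $$\left|\,\mathcal{E}_{n}(C^{\psi}_{\beta,1})_{C}-\frac{1}{\pi}\sum_{k=n}^{\infty}\psi(k)\right|\le \frac{K}{n}\sum_{k=1}^{\infty}k\,\psi(k+n).$$ That is, as $n\to\infty$, $\mathcal{E}_{n}(C^{\psi}_{\beta,1})_{C}=\frac{1}{\pi}\sum_{k=n}^{\infty}\psi(k)+\frac{\mathcal{O}(1)}{n}\sum_{k=1}^{\infty}k\,\psi(k+n)$, where $\mathcal{O}(1)$ is a quantity uniformly bounded in all parameters ($n$, $\psi$, $\beta$).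
   Context: $L_1$ is the space of $2\pi$-periodic functions summable on $[0,2\pi)$, with norm $\|f\|_1=\int_0^{2\pi}|f(t)|\,dt$. $C$ is the space of continuous $2\pi$-periodic functions with norm $\|f\|_C=\max_t|f(t)|$. All functions are real-valued. $B_1^0=\{\varphi\in L_1:\ \|\varphi\|_1\le 1,\ \varphi\perp 1\}$, where $\varphi\perp 1$ means $\int_{-\pi}^{\pi}\varphi(t)\,dt=0$. For a sequence $\psi(k)\ge 0$, $k\ge1$, with $\sum_{k=1}^\infty\psi(k)<\infty$ and $\beta\in\mathbb{R}$, put $\Psi_\beta(t)=\sum_{k=1}^\infty\psi(k)\cos\left(kt-\frac{\beta\pi}{2}\right)$. The class $C^{\psi}_{\beta,1}$ is the set of all functions $f$ which are represented for all $x$ in the form $$f(x)=\frac{a_0}{2}+\frac1\pi\int_{-\pi}^{\pi}\varphi(t)\,\Psi_\beta(x-t)\,dt,\qquad a_0\in\mathbb{R},\ \varphi\in B_1^0 .$$ One has $C^{\psi}_{\beta,1}\subset C$. $\mathcal{E}_{n}(C^{\psi}_{\beta,1})_{C}=\sup_{f\in C^{\psi}_{\beta,1}}\|f(\cdot)-S_{n-1}(f;\cdot)\|_{C}$, where $S_{n-1}(f;\cdot)$ is the partial Fourier sum of order $n-1$ of $f$, i.e. $S_{n-1}(f;x)=\frac{a_0(f)}{2}+\sum_{k=1}^{n-1}(a_k(f)\cos kx+b_k(f)\sin kx)$ with $a_k(f),b_k(f)$ the Fourier coefficients of $f$. *)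

(* Defs.v *)
From HB Require Import structures.
From mathcomp Require Export all_boot all_order all_algebra.
From mathcomp Require Export all_classical all_reals all_analysis.

Set Implicit Arguments.
Unset Strict Implicit.
Unset Printing Implicit Defensive.

Import Order.TTheory GRing.Theory Num.Theory.
Import numFieldNormedType.Exports.

Local Open Scope classical_set_scope.
Local Open Scope ring_scope.

Section Defs.
Context {R : realType}.
Local Notation mu := (@lebesgue_measure R).
Implicit Types (f phi : R -> R) (psi : nat -> R) (beta : R).

Definition L1 : set (R -> R) :=
  [set f | periodic f (pi *+ 2) /\
           mu.-integrable `[0, pi *+ 2[ (EFin \o f)].

Definition L1_norm f : R := \int[mu]_(t in `[0, pi *+ 2[) `|f t|.

(* For a continuous 2pi-periodic g the supremum is a maximum.  It is taken in
   the extended reals so that it is meaningful for every g. *)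
Definition C_norm (g : R -> R) : \bar R :=
  ereal_sup [set `|g t|%:E | t in [set: R]].

Definition B10 : set (R -> R) :=
  [set phi | [/\ L1 phi, L1_norm phi <= 1 &
                 \int[mu]_(t in `[- pi, pi]) phi t = 0]].

(* Here and below, psi 0 is never used: a sequence (psi(k))_{k >= 1} is
   encoded by a function on nat whose value at 0 is irrelevant. *)
Definition Psi psi beta (t : R) : R :=
  \big[+%R/0]_(1 <= k <oo) (psi k * cos (k%:R * t - beta * pi / 2)).

Definition Cpsi psi beta : set (R -> R) :=
  [set f | exists a0 : R, exists2 phi, B10 phi &
    forall x, f x = a0 / 2 +
      pi^-1 * \int[mu]_(t in `[- pi, pi]) (phi t * Psi psi beta (x - t))].

Definition fourier_a f (k : nat) : R :=
  pi^-1 * \int[mu]_(t in `[- pi, pi]) (f t * cos (k%:R * t)).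

Definition fourier_b f (k : nat) : R :=
  pi^-1 * \int[mu]_(t in `[- pi, pi]) (f t * sin (k%:R * t)).

Definition fourier_sum f (m : nat) (x : R) : R :=
  fourier_a f 0%N / 2 +
  \sum_(1 <= k < m.+1)
    (fourier_a f k * cos (k%:R * x) + fourier_b f k * sin (k%:R * x)).

(* For n >= 1 (the predecessor n.-1 is truncated at n = 0). *)
Definition E_n psi beta (n : nat) : \bar R :=
  ereal_sup [set C_norm (fun x => f x - fourier_sum f n.-1 x)
            | f in Cpsi psi beta].

End Defs.

(* Main.v *)
Require Import Defs.
From mathcomp Require Import all_boot all_order all_algebra.
From mathcomp Require Import all_classical all_reals all_analysis.
From mathcomp Require Import measurable_realfun ring lra.

Set Implicit Arguments.
Unset Strict Implicit.
Unset Printing Implicit Defensive.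
Import Order.TTheory GRing.Theory Num.Theory.
Import numFieldNormedType.Exports.

Local Open Scope classical_set_scope.
Local Open Scope ring_scope.

(** Write T_n for the sum of psi(k) over k >= n, J_n for the sum of
    (k - n) psi(k) over k >= n, and Psi_n for the tail of the kernel Psi_beta
    starting at k = n.  The theorem holds with K = 1, and T_n / pi is always an
    upper bound.

    If f = a0/2 + (1/pi) phi * Psi_beta, then cutting the kernel after its first
    N - 1 harmonics leaves a trigonometric polynomial plus an error of size at
    most ||phi||_1 T_N / pi, uniformly in x.  So f is a uniform limit of
    trigonometric polynomials with stable coefficients; by orthogonality those
    are its Fourier coefficients ([fourier_sum_uniform]), and
        f - S_{n-1}(f) = (1/pi) phi * Psi_n        ([deviation_integral]).
    As |Psi_n| <= T_n and ||phi||_1 <= 1,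
    the upper bound [E_n_le] follows.

    For the lower bound, phi ranges over functions of mean zero and norm at most
    1, so phi may be taken close to half the difference of two Dirac masses; the
    deviation at x is then nearly (Psi_n(t0) - Psi_n(t1)) / (2 pi) for any two
    points t0, t1 that differ by the distance of the two masses.  The points are
    chosen so that the lowest harmonic cos(nt - beta pi/2) equals 1 at t0 and -1
    at t1, both within pi/n of the origin ([antipodal_points]).  The k-th harmonic
    differs there from the n-th one by a phase (k - n) t of modulus at most
    (k - n) pi/n, and 1 - cos y <= |y|, whence
        Psi_n(t0) >= T_n - (pi/n) J_n   and   Psi_n(t1) <= -T_n + (pi/n) J_n.
    Replacing the Dirac masses by bumps of width h costs at most h times the sum
    of k psi(k) ([Psi_tail_near_peak], [E_n_ge]); letting h tend to 0 gives
        E_n >= T_n / pi - J_n / n,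
    and J_n is the series in the remainder, reindexed. *)

(** * Integrals of periodic functions over shifted windows *)

Section shift.
Context {R : realType}.
Local Notation mu := (@lebesgue_measure R).

Lemma preimage_addr_itv (c : R) (b0 b1 : bool) (x y : R) :
  (fun t : R => t + c) @^-1` [set` Interval (BSide b0 x) (BSide b1 y)] =
  [set` Interval (BSide b0 (x - c)) (BSide b1 (y - c))].
Proof.
apply/seteqP; split => t /=; rewrite !in_itv /=;
  by case: b0; case: b1; rewrite /= ?(lerBlDr, ltrBlDr, lerBrDr, ltrBrDr).
Qed.

Lemma measurable_addr (c : R) :
  measurable_fun [set: R] ((fun t : R => t + c) : _ -> measurableTypeR R).
Proof. by apply: continuous_measurable_fun => x; apply: continuousD; [exact: cvg_id|exact: cvg_cst]. Qed.

(** Lebesgue measure is determined by its values on half-open intervals, and those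
    depend on the length only. *)
Lemma lebesgue_measure_shift (c : R) (A : set R) : measurable A ->
  pushforward mu ((fun t : R => t + c) : _ -> measurableTypeR R) A = mu A.
Proof.
move=> mA; apply/esym/(lebesgue_measure_unique
  (mu := pushforward mu ((fun t : R => t + c) : _ -> measurableTypeR R))) => //.
  exact: measurable_addr.
move=> mf; move=> _ [[a b]] _ <-.
rewrite -[RHS]/(mu ((fun t : R => t + c) @^-1` `]a, b]%classic)).
rewrite preimage_addr_itv /= !lebesgue_measure_itv/=.
rewrite !lte_fin ltrD2r; case: ifP => // _.
by rewrite -!EFinB; congr (_%:E); ring.
Qed.

Lemma ge0_integral_shift (c : R) (D : set R) (f : R -> \bar R) :
  measurable D -> measurable_fun D f -> (forall x, D x -> (0 <= f x)%E) ->
  (\int[mu]_(x in D) f x =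
   \int[mu]_(x in (fun t => t + c)%R @^-1` D) f (x + c)%R)%E.
Proof.
move=> mD mf f0.
rewrite -(@ge0_integral_pushforward _ _ (measurableTypeR R) (measurableTypeR R) R _ (measurable_addr c) mu D f)//; last first.
  by move=> y; rewrite inE; exact: f0.
apply: eq_measure_integral => [|mshift A mA AD]; first exact: measurable_addr.
exact/esym/(lebesgue_measure_shift c).
Qed.
End shift.

Section period.
Context {R : realType}.
Local Notation mu := (@lebesgue_measure R).

Lemma integrable_shift (c : R) (D : set R) (f : R -> R) : measurable D ->
  mu.-integrable D (EFin \o f) ->
  mu.-integrable ((fun t => t + c) @^-1` D) (EFin \o (fun t => f (t + c))).
Proof.
move=> mD fi; have [mf foo] := integrableP _ _ _ fi.
apply/integrableP; split.
  apply/measurable_EFinP; apply: (measurable_comp (F := D)) => //.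
  - by move=> _ [t /= Dt <-].
  - exact/measurable_EFinP.
  - exact: (measurable_funTS (measurable_addr c)).
rewrite (ge0_integral_shift c mD) in foo => //.
exact: measurableT_comp.
Qed.

Lemma Rintegral_shift (c : R) (D : set R) (f : R -> R) : measurable D ->
  mu.-integrable D (EFin \o f) ->
  \int[mu]_(t in D) f t = \int[mu]_(t in (fun t => t + c) @^-1` D) f (t + c).
Proof.
move=> mD /integrableP[mf foo]; rewrite /Rintegral; congr fine.
rewrite integralE [RHS]integralE; congr (_ - _)%E.
  rewrite (ge0_integral_shift c) //; last exact: measurable_funepos.
  by apply: eq_integral => t _; rewrite !funeposE.
rewrite (ge0_integral_shift c) //; last exact: measurable_funeneg.
by apply: eq_integral => t _; rewrite !funenegE.
Qed.

Lemma disjoint_itvco (x y z : R) : [disjoint `[x, y[ & `[y, z[]%classic.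
Proof.
apply/disj_setPS => t /= [].
rewrite !in_itv/= => /andP[_ ty] /andP[yt _].
by have := lt_le_trans ty yt; rewrite ltxx.
Qed.

(** The part of the window to the right of c is moved one period to the left; this
    reconciles the norm taken over [0, 2 pi) with integrals over [-pi, pi]. *)
Lemma periodic_window (T a c : R) (f : R -> R) : a <= c -> c <= a + T ->
  periodic f T -> mu.-integrable `[a, a + T[ (EFin \o f) ->
  mu.-integrable `[c - T, c[ (EFin \o f) /\
  \int[mu]_(t in `[c - T, c[) f t = \int[mu]_(t in `[a, a + T[) f t.
Proof.
move=> ac caT fT fi.
have shiftE : (fun t : R => t + T) @^-1` `[c, a + T[ = `[c - T, a[%classic.
  by rewrite preimage_addr_itv addrK.
have fTE : (fun t => f (t + T)) = f by apply/funext => t; exact: fT.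
have U1 : `[a, a + T[%classic = `[a, c[ `|` `[c, a + T[ :> set R.
  by apply: itv_bndbnd_setU; rewrite bnd_simp.
have U2 : `[c - T, c[%classic = `[c - T, a[ `|` `[a, c[ :> set R.
  by apply: itv_bndbnd_setU; rewrite bnd_simp// lerBlDr.
have fi1 : mu.-integrable `[a, c[ (EFin \o f).
  by apply: integrableS fi => //; rewrite U1; exact: subsetUl.
have fi2 : mu.-integrable `[c, a + T[ (EFin \o f).
  by apply: integrableS fi => //; rewrite U1; exact: subsetUr.
have fi3 : mu.-integrable `[c - T, a[ (EFin \o f).
  by rewrite -shiftE -fTE; exact: integrable_shift.
have fi4 : mu.-integrable `[c - T, c[ (EFin \o f).
  have /integrableP[m1 b1] := fi1; have /integrableP[m3 b3] := fi3.
  have m4 : measurable_fun `[c - T, c[ (EFin \o f).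
    by rewrite U2; apply/measurable_funU.
  apply/integrableP; split => //.
  rewrite U2 ge0_integral_setU//; first exact: lte_add_pinfty.
    by rewrite -U2; exact: measurableT_comp.
  exact: disjoint_itvco.
split=> //.
rewrite U2 Rintegral_setU -?U2//; last exact: disjoint_itvco.
rewrite U1 Rintegral_setU -?U1//; last exact: disjoint_itvco.
by rewrite addrC (Rintegral_shift T _ fi2)// shiftE fTE.
Qed.
End period.

(** * Orthogonality of the trigonometric system *)

Section trig.
Context {R : realType}.
Local Notation mu := (@lebesgue_measure R).
Local Notation I := (`[- pi, pi]%classic : set R).

Lemma lebesgue_measure_window : mu I = (pi *+ 2)%:E.
Proof.
rewrite lebesgue_measure_itv/= lte_fin gtrN ?pi_gt0//.
by rewrite -EFinB opprK mulr2n.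
Qed.

Lemma Rintegral_cst_window (r : R) : \int[mu]_(t in I) r = r * (pi *+ 2).
Proof.
by rewrite Rintegral_cst//; congr (_ * _); exact: (congr1 fine lebesgue_measure_window).
Qed.

Lemma bounded_integrable (f : R -> R) (M : R) (b0 b1 : bool) (a b : R) :
  measurable_fun [set` Interval (BSide b0 a) (BSide b1 b)] f ->
  (forall t, `|f t| <= M) ->
  mu.-integrable [set` Interval (BSide b0 a) (BSide b1 b)] (EFin \o f).
Proof.
move=> mf fM; apply: measurable_bounded_integrable => //=.
  by rewrite lebesgue_measure_itv/=; case: ifP => // _; rewrite -EFinB ltry.
exists M; split; first exact: num_real.
by move=> x Mx t _; exact: le_trans (fM t) (ltW Mx).
Qed.

Lemma Rintegral_derive (F f : R -> R) (a b : R) : a < b -> continuous f ->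
  (forall x : R, is_derive x (1 : R) F (f x)) ->
  \int[mu]_(t in `[a, b]) f t = F b - F a.
Proof.
move=> ab cf dF.
have cF : continuous F.
  move=> x; apply: differentiable_continuous; apply/derivable1_diffP.
  by have [] := dF x.
rewrite /Rintegral (@continuous_FTC2 _ f F)//.
- by apply: continuous_subspaceT.
- split.
  + by move=> x _; have [] := dF x.
  + exact/cvg_at_right_filter/cF.
  + exact/cvg_at_left_filter/cF.
- by move=> x _; rewrite derive1E; have [_ ->] := dF x.
Qed.

Lemma continuous_cosM (m : R) : continuous (fun t : R => cos (m * t)).
Proof.
move=> x; apply: (@continuous_comp _ _ _ ( *%R m) cos).
  exact: mulrl_continuous.
exact: continuous_cos.
Qed.

Lemma continuous_sinM (m : R) : continuous (fun t : R => sin (m * t)).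
Proof.
move=> x; apply: (@continuous_comp _ _ _ ( *%R m) sin).
  exact: mulrl_continuous.
exact: continuous_sin.
Qed.

Lemma sin_natpi (k : nat) : sin (k%:R * pi) = 0 :> R.
Proof.
elim: k => [|k IH]; first by rewrite mul0r sin0.
by rewrite -natr1 mulrDl mul1r sinDpi IH oppr0.
Qed.

Lemma integral_cosM (m : R) : m != 0 -> sin (m * pi) = 0 ->
  \int[mu]_(t in I) cos (m * t) = 0.
Proof.
move=> m0 spi.
have dF (x : R) : is_derive x (1 : R) (fun t => m^-1 * sin (m * t)) (cos (m * x)).
  apply: is_derive_eq.
  by rewrite /GRing.scale /=; field.
rewrite (@Rintegral_derive (fun t => m^-1 * sin (m * t)) (fun x => cos (m * x)) _ _ _ _ dF).
- by rewrite mulrN sinN spi oppr0 subrr.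
- by rewrite gtrN ?pi_gt0.
- exact: continuous_cosM.
Qed.

Lemma integral_sinM (m : R) : \int[mu]_(t in I) sin (m * t) = 0.
Proof.
have [->|m0] := eqVneq m 0.
  by under eq_Rintegral do rewrite mul0r sin0; rewrite Rintegral_cst// mul0r.
have dF (x : R) : is_derive x (1 : R) (fun t => - m^-1 * cos (m * t)) (sin (m * x)).
  apply: is_derive_eq.
  by rewrite /GRing.scale /=; field.
rewrite (@Rintegral_derive (fun t => - m^-1 * cos (m * t)) (fun x => sin (m * x)) _ _ _ _ dF).
- by rewrite mulrN cosN subrr.
- by rewrite gtrN ?pi_gt0.
- exact: continuous_sinM.
Qed.

Lemma integrable_cosM (m : R) : mu.-integrable I (EFin \o (fun t => cos (m * t))).
Proof.
apply: (@bounded_integrable _ 1) => [|t]; last exact: cos_max.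
apply: measurable_funTS; apply: continuous_measurable_fun; exact: continuous_cosM.
Qed.

Lemma integrable_sinM (m : R) : mu.-integrable I (EFin \o (fun t => sin (m * t))).
Proof.
apply: (@bounded_integrable _ 1) => [|t]; last exact: sin_max.
apply: measurable_funTS; apply: continuous_measurable_fun; exact: continuous_sinM.
Qed.

Lemma RintegralZl_half (f g : R -> R) :
  mu.-integrable I (EFin \o f) -> mu.-integrable I (EFin \o g) ->
  \int[mu]_(t in I) (2^-1 * (f t + g t)) =
  2^-1 * (\int[mu]_(t in I) f t + \int[mu]_(t in I) g t).
Proof.
move=> fi gi; rewrite RintegralZl//; last exact: (@integrableD _ _ _ mu I _ (EFin \o f) (EFin \o g)).
by rewrite RintegralD.
Qed.

Lemma integral_cos_nat (j k : nat) :
  \int[mu]_(t in I) cos ((k%:R - j%:R) * t) = if k == j then pi *+ 2 else 0.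
Proof.
case: eqVneq => [->|kj].
  under eq_Rintegral do rewrite subrr mul0r cos0.
  by rewrite Rintegral_cst_window mul1r.
rewrite integral_cosM// ?subr_eq0 ?eqr_nat//.
by rewrite mulrBl sinB !sin_natpi mul0r mulr0 subrr.
Qed.

Lemma integral_cos_natD (j k : nat) :
  \int[mu]_(t in I) cos ((k%:R + j%:R) * t) =
  if (k == 0%N) && (j == 0%N) then pi *+ 2 else 0.
Proof.
by have := integral_cos_nat 0 (k + j); rewrite mulr0n subr0 natrD addn_eq0.
Qed.

Lemma integral_coscos (j k : nat) :
  \int[mu]_(t in I) (cos (k%:R * t) * cos (j%:R * t)) =
  if k == j then (if k == 0%N then pi *+ 2 else pi) else 0.
Proof.
under eq_Rintegral => t _.
  rewrite (_ : _ * _ = 2^-1 * (cos ((k%:R - j%:R) * t) + cos ((k%:R + j%:R) * t))).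
    over.
  by rewrite mulrBl mulrDl cosB cosD; field.
rewrite RintegralZl_half; [|exact: integrable_cosM..].
rewrite integral_cos_nat integral_cos_natD.
case: eqVneq => [->|kj]; first by case: eqVneq => _ /=; field.
case: eqVneq => [k0|_]; case: eqVneq => [j0|_] /=; try by rewrite addr0 mulr0.
by move: kj; rewrite k0 j0 eqxx.
Qed.

Lemma integral_sinsin (j k : nat) :
  \int[mu]_(t in I) (sin (k%:R * t) * sin (j%:R * t)) =
  if (k == j) && (k != 0%N) then pi else 0.
Proof.
under eq_Rintegral => t _.
  rewrite (_ : _ * _ = 2^-1 * (cos ((k%:R - j%:R) * t) + -1 * cos ((k%:R + j%:R) * t))).
    over.
  by rewrite mulrBl mulrDl cosB cosD; field.
have ci := integrable_cosM (k%:R + j%:R).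
rewrite RintegralZl_half; [|exact: integrable_cosM|exact: (@integrableZl _ _ _ mu I _ _ (EFin \o _))].
rewrite RintegralZl// integral_cos_nat integral_cos_natD.
case: eqVneq => [->|kj]; first by case: eqVneq => _ /=; field.
case: eqVneq => [k0|_]; case: eqVneq => [j0|_] /=; try by rewrite mulr0 addr0 mulr0.
by move: kj; rewrite k0 j0 eqxx.
Qed.

Lemma integral_sincos (m p : R) :
  \int[mu]_(t in I) (sin (m * t) * cos (p * t)) = 0.
Proof.
under eq_Rintegral => t _.
  rewrite (_ : _ * _ = 2^-1 * (sin ((m + p) * t) + sin ((m - p) * t))).
    over.
  by rewrite mulrBl mulrDl sinB sinD; field.
rewrite RintegralZl_half; [|exact: integrable_sinM..].
by rewrite !integral_sinM addr0 mulr0.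
Qed.
End trig.

(** * Fourier sums of uniform limits of trigonometric polynomials *)

Section fourier.
Context {R : realType}.
Local Notation mu := (@lebesgue_measure R).
Local Notation I := (`[- pi, pi]%classic : set R).

Definition trig_poly (c : R) (p q : nat -> R) (N : nat) (x : R) : R :=
  c / 2 + \sum_(1 <= k < N) (p k * cos (k%:R * x) + q k * sin (k%:R * x)).

Lemma integrable_contM (f g : R -> R) : continuous f -> continuous g ->
  (forall t, `|f t| <= 1) -> (forall t, `|g t| <= 1) ->
  mu.-integrable I (EFin \o (fun t => f t * g t)).
Proof.
move=> cf cg f1 g1; apply: (@bounded_integrable _ _ 1).
  apply: measurable_funTS; apply: continuous_measurable_fun => x.
  by apply: continuousM; [exact: cf|exact: cg].
by move=> t; rewrite normrM mulr_ile1.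
Qed.

Lemma integral_trig_polyM c p q N (w : R -> R) : continuous w ->
  (forall t, `|w t| <= 1) ->
  mu.-integrable I (EFin \o (fun t => trig_poly c p q N t * w t)) /\
  \int[mu]_(t in I) (trig_poly c p q N t * w t) =
  c / 2 * \int[mu]_(t in I) w t +
  \sum_(1 <= k < N) (p k * \int[mu]_(t in I) (cos (k%:R * t) * w t)
                   + q k * \int[mu]_(t in I) (sin (k%:R * t) * w t)).
Proof.
move=> cw w1.
have wi : mu.-integrable I (EFin \o w).
  apply: (@bounded_integrable _ _ 1) => //.
  by apply: measurable_funTS; apply: continuous_measurable_fun.
have ZI (f : R -> R) r : mu.-integrable I (EFin \o f) ->
    mu.-integrable I (EFin \o (fun t => r * f t)).
  by move=> fi; exact: (@integrableZl _ _ _ mu I _ _ (EFin \o _)).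
have DI (f g : R -> R) : mu.-integrable I (EFin \o f) ->
    mu.-integrable I (EFin \o g) -> mu.-integrable I (EFin \o (fun t => f t + g t)).
  by move=> fi gi; exact: (@integrableD _ _ _ mu I _ (EFin \o _) (EFin \o _)).
have ci k : mu.-integrable I (EFin \o (fun t => cos (k%:R * t) * w t)).
  apply: integrable_contM => //; first exact: continuous_cosM.
  by move=> t; exact: cos_max.
have si k : mu.-integrable I (EFin \o (fun t => sin (k%:R * t) * w t)).
  apply: integrable_contM => //; first exact: continuous_sinM.
  by move=> t; exact: sin_max.
elim: N => [|N [IH1 IH2]].
  rewrite big_geq// addr0 -RintegralZl//.
  rewrite (_ : (fun t => _) = (fun t => c / 2 * w t)); last first.
    by apply/funext => t; rewrite /trig_poly big_geq// addr0.
  by split => //; exact: ZI.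
have [->|N0] := posnP N.
  rewrite big_geq// addr0 -RintegralZl//.
  rewrite (_ : (fun t => _) = (fun t => c / 2 * w t)); last first.
    by apply/funext => t; rewrite /trig_poly big_geq// addr0.
  by split => //; exact: ZI.
have E : (fun t => trig_poly c p q N.+1 t * w t) =
    (fun t => trig_poly c p q N t * w t +
      (p N * (cos (N%:R * t) * w t) + q N * (sin (N%:R * t) * w t))).
  by apply/funext => t; rewrite /trig_poly big_nat_recr//=; ring.
have Ti : mu.-integrable I (EFin \o
    (fun t => p N * (cos (N%:R * t) * w t) + q N * (sin (N%:R * t) * w t))).
  by apply: DI; exact: ZI.
rewrite E; split; first exact: DI.
rewrite RintegralD//.
rewrite RintegralD//; try exact: ZI.
rewrite (RintegralZl _ _ (ci N))// (RintegralZl _ _ (si N))//.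
by rewrite IH2 -addrA big_nat_recr.
Qed.

Lemma fourier_a_trig_poly c p q N j : (j < N)%N ->
  fourier_a (trig_poly c p q N) j = if j == 0%N then c else p j.
Proof.
move=> jN; rewrite /fourier_a.
have [_ ->] := integral_trig_polyM c p q N (@continuous_cosM R j%:R)
  (fun t => cos_max _).
under eq_big_nat => k _ do rewrite integral_coscos integral_sincos mulr0 addr0.
have pi0 : (pi : R) != 0 by rewrite gt_eqF// pi_gt0.
have [->|j0] := posnP j.
  rewrite big_nat_cond big1 => [|k /andP[/andP[k0 _] _]]; last first.
    by rewrite gtn_eqF// mulr0.
  under eq_Rintegral do rewrite mul0r cos0.
  rewrite Rintegral_cst_window.
  by move: pi pi0 => P P0; field.
rewrite integral_cosM ?sin_natpi// ?pnatr_eq0 -?lt0n// mulr0 add0r.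
rewrite (bigD1_seq j) ?mem_index_iota ?j0 ?iota_uniq//=.
rewrite eqxx gtn_eqF// big1 ?addr0 => [|k kj]; last by rewrite (negbTE kj) mulr0.
by move: pi pi0 => P P0; field.
Qed.

Lemma fourier_b_trig_poly c p q N j : (0 < j < N)%N ->
  fourier_b (trig_poly c p q N) j = q j.
Proof.
move=> /andP[j0 jN]; rewrite /fourier_b.
have [_ ->] := integral_trig_polyM c p q N (@continuous_sinM R j%:R)
  (fun t => sin_max _).
have cs k : \int[mu]_(t in I) (cos (k%:R * t) * sin (j%:R * t)) = 0.
  by under eq_Rintegral do rewrite mulrC; rewrite integral_sincos.
under eq_big_nat => k _ do rewrite cs integral_sinsin mulr0 add0r.
have pi0 : (pi : R) != 0 by rewrite gt_eqF// pi_gt0.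
rewrite integral_sinM mulr0 add0r.
rewrite (bigD1_seq j) ?mem_index_iota ?j0 ?iota_uniq//=.
rewrite eqxx -lt0n j0 big1 ?addr0 => [|k kj]; last by rewrite (negbTE kj) mulr0.
by move: pi pi0 => P P0; rewrite /=; field.
Qed.

Lemma continuous_trig_poly c p q N : continuous (trig_poly c p q N).
Proof.
elim: N => [|N IH].
  rewrite (_ : trig_poly c p q 0 = cst (c / 2)); first exact: cst_continuous.
  by apply/funext => t; rewrite /trig_poly big_geq// addr0.
have [->|N0] := posnP N.
  rewrite (_ : trig_poly c p q 1 = cst (c / 2)); first exact: cst_continuous.
  by apply/funext => t; rewrite /trig_poly big_geq// addr0.
rewrite (_ : trig_poly c p q N.+1 = fun t => trig_poly c p q N t +
    (p N * cos (N%:R * t) + q N * sin (N%:R * t))); last first.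
  by apply/funext => t; rewrite /trig_poly big_nat_recr//= addrA.
move=> x; apply: continuousD; first exact: IH.
apply: continuousD; apply: continuousM; try exact: cst_continuous.
- exact: continuous_cosM.
- exact: continuous_sinM.
Qed.

(** The factor 2 is the length 2 pi of the window divided by pi. *)
Lemma fourier_coef_close (f g w : R -> R) (e : R) :
  measurable_fun I f -> continuous g -> continuous w -> (forall t, `|w t| <= 1) ->
  mu.-integrable I (EFin \o (fun t => g t * w t)) ->
  (forall t, `|f t - g t| <= e) ->
  `|pi^-1 * \int[mu]_(t in I) (f t * w t) - pi^-1 * \int[mu]_(t in I) (g t * w t)|
    <= e *+ 2.
Proof.
move=> mf cg cw w1 gwi fge.
have e0 : 0 <= e by exact: le_trans (fge 0).
have mg : measurable_fun I g.
  by apply: measurable_funTS; exact: continuous_measurable_fun.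
have mw : measurable_fun I w.
  by apply: measurable_funTS; exact: continuous_measurable_fun.
pose d t := (f t - g t) * w t.
have dle t : `|d t| <= e by rewrite /d normrM -[e]mulr1 ler_pM.
have di : mu.-integrable I (EFin \o d).
  apply: (@bounded_integrable _ _ e) => //.
  by apply: measurable_funM => //; exact: measurable_funB.
rewrite (_ : \int[mu]_(t in I) (f t * w t) =
    \int[mu]_(t in I) (g t * w t) + \int[mu]_(t in I) d t); last first.
  rewrite -RintegralD//; apply: eq_Rintegral => t _; rewrite /d; ring.
rewrite -mulrBr addrC addKr normrM gtr0_norm ?invr_gt0 ?pi_gt0//.
rewrite ler_pdivrMl ?pi_gt0//.
apply: (le_trans (le_normr_Rintegral _ di)) => //.
have : \int[mu]_(t in I) `|d t| <= \int[mu]_(t in I) e.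
  apply: le_Rintegral => //; first exact: integrable_norm.
  by apply: (@bounded_integrable _ _ e) => // t; rewrite ger0_norm.
rewrite Rintegral_cst_window.
by rewrite mulrC mulrnAl -mulrnAr.
Qed.

(** Each Fourier coefficient is continuous for the uniform norm, and on the N-th
    approximant it is eventually the constant prescribed by p or q. *)
Lemma fourier_sum_uniform c p q (f : R -> R) (e : nat -> R) m x :
  e @ \oo --> 0 ->
  (forall N, (0 < N)%N -> forall t, `|f t - trig_poly c p q N t| <= e N) ->
  fourier_sum f m x = trig_poly c p q m.+1 x.
Proof.
move=> e0 fe.
have mf : measurable_fun I f.
  apply: (@measurable_fun_cvg _ _ _ I (fun N => trig_poly c p q N)).
    move=> N; apply: measurable_funTS; apply: continuous_measurable_fun.
    exact: continuous_trig_poly.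
  move=> t _; apply/cvgrPdist_le => r r0.
  move/cvgrPdist_le : e0 => /(_ r r0) e0.
  near=> N.
  have N0 : (0 < N)%N by near: N; exists 1%N.
  apply: le_trans (fe N N0 t) _; rewrite (le_trans (ler_norm _))//.
  by rewrite -normrN -sub0r; near: N.
have lim (a b : R) j : (forall N, (j < N)%N -> `|a - b| <= e N *+ 2) -> a = b.
  move=> H; apply/eqP; rewrite -subr_eq0 -normr_le0.
  have e20 : (fun N => e N *+ 2) @ \oo --> (0 : R).
    by rewrite -(mul0rn _ 2); apply: cvgMn.
  rewrite -(cvg_lim _ e20)//; apply: limr_ge; first by apply/cvg_ex; exists 0.
  by exists j.+1.
have aE j : fourier_a f j = if j == 0%N then c else p j.
  apply: (lim _ _ j) => N jN; rewrite -(fourier_a_trig_poly c p q jN).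
  apply: fourier_coef_close => //.
  - exact: continuous_trig_poly.
  - exact: continuous_cosM.
  - by move=> t; exact: cos_max.
  - exact: (integral_trig_polyM c p q N (@continuous_cosM R j%:R) (fun t => cos_max _)).1.
  - by apply: fe; exact: leq_trans jN.
have bE j : (0 < j)%N -> fourier_b f j = q j.
  move=> j0; apply: (lim _ _ j) => N jN.
  rewrite -(@fourier_b_trig_poly c p q N) ?j0//.
  apply: fourier_coef_close => //.
  - exact: continuous_trig_poly.
  - exact: continuous_sinM.
  - by move=> t; exact: sin_max.
  - exact: (integral_trig_polyM c p q N (@continuous_sinM R j%:R) (fun t => sin_max _)).1.
  - by apply: fe; exact: leq_trans jN.
rewrite /fourier_sum /trig_poly aE eqxx; congr (_ + _).
apply: eq_big_nat => k /andP[k0 _].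
by rewrite aE bE// gtn_eqF.
Unshelve. all: by end_near. Qed.
End fourier.

(** * Series summed from an arbitrary index *)

Section series.
Context {R : realType}.
Implicit Types (a b : nat -> R) (m : nat).

Lemma sum_from_series m a :
  (fun N => \sum_(m <= k < N) a k) = series (fun k => if (m <= k)%N then a k else 0).
Proof.
apply/funext => N; rewrite seriesEnat /= -big_mkcond /=.
by rewrite [LHS](big_nat_widenl m 0).
Qed.

Lemma cvg_sum_from m m' a : cvgn (fun N => \sum_(m <= k < N) a k) ->
  cvgn (fun N => \sum_(m' <= k < N) a k).
Proof. by rewrite !is_cvg_series_restrict. Qed.

Lemma sum_from_dominated m a b : (forall k, (m <= k)%N -> `|a k| <= b k) ->
  cvgn (fun N => \sum_(m <= k < N) b k) ->
  cvgn (fun N => \sum_(m <= k < N) a k) /\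
  `|\big[+%R/0]_(m <= k <oo) a k| <= \big[+%R/0]_(m <= k <oo) b k.
Proof.
move=> ab cb.
have cn : cvgn (fun N => \sum_(m <= k < N) `|a k|).
  move: cb; rewrite !sum_from_series; apply: series_le_cvg => k; case: ifP => // mk.
    by apply: le_trans (ab k mk).
  exact: ab.
have ca : cvgn (fun N => \sum_(m <= k < N) a k).
  rewrite sum_from_series; apply: normed_cvg; move: cn.
  rewrite sum_from_series (_ : (fun k => if _ then `|a k| else 0) =
    (fun k => `|if (m <= k)%N then a k else 0|))//.
  by apply/funext => k; case: ifP => //; rewrite normr0.
split=> //; rewrite -lim_norm//; apply: ler_lim => //; first exact: is_cvg_norm.
apply: nearW => N; apply: le_trans (ler_norm_sum _ _ _) _.
rewrite big_nat_cond [leRHS]big_nat_cond; apply: ler_sum => k /andP[/andP[mk _] _].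
exact: ab.
Qed.

Lemma sum_from_split m n a : (m <= n)%N -> cvgn (fun N => \sum_(m <= k < N) a k) ->
  \big[+%R/0]_(m <= k <oo) a k =
  \sum_(m <= k < n) a k + \big[+%R/0]_(n <= k <oo) a k.
Proof.
move=> mn ca; have cn : cvgn (fun N => \sum_(n <= k < N) a k) by exact: cvg_sum_from ca.
apply/cvg_lim => //.
have : (fun N => \sum_(m <= k < n) a k + \sum_(n <= k < N) a k) @ \oo -->
   \sum_(m <= k < n) a k + \big[+%R/0]_(n <= k <oo) a k.
  by apply: cvgD; [exact: cvg_cst|exact: cn].
apply: cvg_trans; apply: near_eq_cvg; near=> N.
rewrite [RHS](big_cat_nat _ (n := n))//=.
by near: N; exists n.
Unshelve. all: by end_near. Qed.

Lemma sum_from_cvg0 m a : cvgn (fun N => \sum_(m <= k < N) a k) ->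
  (fun N => \big[+%R/0]_(N <= k <oo) a k) @ \oo --> 0.
Proof.
move=> ca; set l := \big[+%R/0]_(m <= k <oo) a k.
have : (fun N => l - \sum_(m <= k < N) a k) @ \oo --> l - l.
  by apply: cvgB; [exact: cvg_cst|exact: ca].
rewrite subrr; apply: cvg_trans; apply: near_eq_cvg; near=> N.
rewrite /l (@sum_from_split m N)//; last by near: N; exists m.
by rewrite addrC addKr.
Unshelve. all: by end_near. Qed.

Lemma le_sum_from m a b : (forall k, (m <= k)%N -> a k <= b k) ->
  cvgn (fun N => \sum_(m <= k < N) a k) ->
  cvgn (fun N => \sum_(m <= k < N) b k) ->
  \big[+%R/0]_(m <= k <oo) a k <= \big[+%R/0]_(m <= k <oo) b k.
Proof.
move=> ab ca cb; apply: ler_lim => //; apply: nearW => N.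
rewrite big_nat_cond [leRHS]big_nat_cond; apply: ler_sum => k /andP[/andP[mk _] _].
exact: ab.
Qed.

Lemma sum_from_lincomb m a b (r : R) :
  cvgn (fun N => \sum_(m <= k < N) a k) -> cvgn (fun N => \sum_(m <= k < N) b k) ->
  cvgn (fun N => \sum_(m <= k < N) (a k + r * b k)) /\
  \big[+%R/0]_(m <= k <oo) (a k + r * b k) =
  \big[+%R/0]_(m <= k <oo) a k + r * \big[+%R/0]_(m <= k <oo) b k.
Proof.
move=> ca cb.
have H : (fun N => \sum_(m <= k < N) (a k + r * b k)) @ \oo -->
  \big[+%R/0]_(m <= k <oo) a k + r * \big[+%R/0]_(m <= k <oo) b k.
  under eq_fun do rewrite big_split -mulr_sumr.
  by apply: cvgD; [exact: ca|apply: cvgM; [exact: cvg_cst|exact: cb]].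
by split; [apply/cvg_ex; eexists; exact: H|exact/cvg_lim].
Qed.

(** The term k = n of the right-hand side vanishes, which is why the two ranges
    correspond under k -> k + n. *)
Lemma sum_from_shift n a :
  cvgn (fun N => \sum_(n <= k < N) ((k - n)%:R * a k)) ->
  \big[+%R/0]_(1 <= k <oo) (k%:R * a (k + n)%N) =
  \big[+%R/0]_(n <= k <oo) ((k - n)%:R * a k).
Proof.
move=> ca; apply/cvg_lim => //;
rewrite -(cvg_shiftn n) in ca.
apply: cvg_trans ca; apply: near_eq_cvg; apply: nearW => N /=.
rewrite -{1}[n]add0n big_addn addnK.
case: N => [|N]; first by rewrite !big_geq.
rewrite big_ltn// add0n subnn mul0r add0r.
by apply: eq_big_nat => k _; rewrite addnK.
Qed.
End series.

(** * The deviation from the Fourier sum as a convolution *)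

Section kernel.
Context {R : realType}.
Local Notation mu := (@lebesgue_measure R).
Local Notation I := (`[- pi, pi]%classic : set R).
Implicit Types (psi : nat -> R) (beta : R) (phi g : R -> R).

Lemma integrable_mul_bounded phi g (M : R) : mu.-integrable I (EFin \o phi) ->
  measurable_fun I g -> (forall t, `|g t| <= M) ->
  mu.-integrable I (EFin \o (fun t => phi t * g t)).
Proof.
move=> phii mg gM.
apply: (@integrableMl _ _ _ mu I _ (EFin \o phi) g) => //.
exists M; split; first exact: num_real.
by move=> x Mx t _; exact: le_trans (gM t) (ltW Mx).
Qed.

Lemma normr_integral_mul_le phi g (M : R) : mu.-integrable I (EFin \o phi) ->
  measurable_fun I g -> (forall t, `|g t| <= M) ->
  `|\int[mu]_(t in I) (phi t * g t)| <= M * \int[mu]_(t in I) `|phi t|.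
Proof.
move=> phii mg gM.
have pgi := integrable_mul_bounded phii mg gM.
apply: (le_trans (le_normr_Rintegral _ pgi)) => //.
have nphii : mu.-integrable I (EFin \o (fun t => `|phi t|)) by exact: integrable_norm.
rewrite -RintegralZl//; apply: le_Rintegral => //.
- exact: integrable_norm.
- exact: (@integrableZl _ _ _ mu I _ _ (EFin \o _)).
- by move=> t _; rewrite normrM mulrC ler_wpM2r.
Qed.

Definition Psi_tail psi beta (n : nat) (t : R) : R :=
  \big[+%R/0]_(n <= k <oo) (psi k * cos (k%:R * t - beta * pi / 2)).

Section summable.
Context (psi : nat -> R) (beta : R).
Context (psi_ge0 : forall k, (1 <= k)%N -> 0 <= psi k).
Context (psi_cvg : cvgn (fun N => \sum_(1 <= k < N) psi k)).

Lemma Psi_tail_le n t : (1 <= n)%N ->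
  cvgn (fun N => \sum_(n <= k < N) (psi k * cos (k%:R * t - beta * pi / 2))) /\
  `|Psi_tail psi beta n t| <= \big[+%R/0]_(n <= k <oo) psi k.
Proof.
move=> n1; apply: sum_from_dominated; last exact: cvg_sum_from psi_cvg.
move=> k nk; have p0 := psi_ge0 (leq_trans n1 nk).
by rewrite normrM ger0_norm// ler_piMr// cos_max.
Qed.

Lemma Psi_tailS n t : (1 <= n)%N -> Psi_tail psi beta n t =
  psi n * cos (n%:R * t - beta * pi / 2) + Psi_tail psi beta n.+1 t.
Proof.
move=> n1; rewrite /Psi_tail (@sum_from_split _ n n.+1)// ?big_nat1//.
by have [] := Psi_tail_le t n1.
Qed.

Lemma measurable_Psi_tail n (A : set R) (x : R) : (1 <= n)%N ->
  measurable_fun A (fun t => Psi_tail psi beta n (x - t)).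
Proof.
move=> n1; apply: (@measurable_fun_cvg _ _ _ A (fun N t => \sum_(n <= k < N)
  (psi k * cos (k%:R * (x - t) - beta * pi / 2)))).
  move=> N; apply: measurable_sum => k; apply: measurable_funTS.
  apply: continuous_measurable_fun => t; apply: continuousM.
    exact: cst_continuous.
  apply: (@continuous_comp _ _ _ (fun t => k%:R * (x - t) - beta * pi / 2) cos).
    apply: continuousB; last exact: cst_continuous.
    apply: continuousM; first exact: cst_continuous.
    by apply: continuousB; [exact: cst_continuous|exact: cvg_id].
  exact: continuous_cos.
by move=> t _; have [] := Psi_tail_le (x - t) n1.
Qed.

Definition conv_cos phi k : R :=
  \int[mu]_(t in I) (phi t * (psi k * cos (k%:R * t + beta * pi / 2))).
Definition conv_sin phi k : R :=
  \int[mu]_(t in I) (phi t * (psi k * sin (k%:R * t + beta * pi / 2))).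

(** Peeling the harmonics off one at a time leaves only finite sums of integrals;
    the variables separate by
    k(x - t) - b = kx - (kt + b) and the subtraction formula of the cosine. *)
Lemma conv_Psi_split phi N x : mu.-integrable I (EFin \o phi) -> (1 <= N)%N ->
  \int[mu]_(t in I) (phi t * Psi psi beta (x - t)) =
  \sum_(1 <= k < N) (conv_cos phi k * cos (k%:R * x) + conv_sin phi k * sin (k%:R * x))
  + \int[mu]_(t in I) (phi t * Psi_tail psi beta N (x - t)).
Proof.
move=> phii; elim: N => // N IH _; have [->|N0] := posnP N.
  by rewrite big_geq// add0r.
rewrite IH// big_nat_recr//= -addrA; congr (_ + _).
have b0 := psi_ge0 N0.
have wave_integrable (w : R -> R) : continuous w -> (forall t, `|w t| <= 1) ->
    mu.-integrable I (EFin \o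
      (fun t => phi t * (psi N * w (N%:R * t + beta * pi / 2)))).
  move=> cw w1; apply: (@integrable_mul_bounded _ _ (psi N)) => //.
    have cF : continuous (w \o (fun t => N%:R * t + beta * pi / 2)).
      move=> s; apply: continuous_comp; last exact: cw.
      apply: continuousD; last exact: cst_continuous.
      exact: mulrl_continuous.
    apply: measurable_funTS; apply: continuous_measurable_fun => t.
    by apply: continuousM; [exact: cst_continuous|exact: cF].
  by move=> t; rewrite normrM (ger0_norm b0) ler_piMr.
have ci := wave_integrable _ (@continuous_cos R) (fun t => cos_max t).
have si := wave_integrable _ (@continuous_sin R) (fun t => sin_max t).
have ti : mu.-integrable I
    (EFin \o (fun t => phi t * Psi_tail psi beta N.+1 (x - t))).
  apply: integrable_mul_bounded => //; first exact: measurable_Psi_tail.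
  by move=> t; have [_] := Psi_tail_le (x - t) (ltn0Sn N); exact.
have ZI (f : R -> R) r : mu.-integrable I (EFin \o f) ->
    mu.-integrable I (EFin \o (fun t => f t * r)).
  move=> fi; rewrite (_ : (fun t => f t * r) = (fun t => r * f t)); last first.
    by apply/funext => t; rewrite mulrC.
  exact: (@integrableZl _ _ _ mu I _ _ (EFin \o _)).
rewrite /conv_cos /conv_sin -RintegralZr// -RintegralZr//.
rewrite -RintegralD//; [|exact: ZI..].
rewrite -RintegralD//; last first.
  by apply: (@integrableD _ _ _ mu I _ (EFin \o _) (EFin \o _)) => //; exact: ZI.
apply: eq_Rintegral => t _; rewrite Psi_tailS//.
rewrite (_ : N%:R * (x - t) - _ = N%:R * x - (N%:R * t + beta * pi / 2)); last by ring.
by rewrite cosB; ring.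
Qed.

(** The errors of the trigonometric approximants in [conv_Psi_split] are bounded by
    tails of the convergent series of psi, so those approximants converge
    uniformly, and their coefficients are the Fourier coefficients of f. *)
Lemma deviation_integral f phi a0 n x : mu.-integrable I (EFin \o phi) ->
  (forall x, f x = a0 / 2 + pi^-1 * \int[mu]_(t in I) (phi t * Psi psi beta (x - t))) ->
  (1 <= n)%N ->
  f x - fourier_sum f n.-1 x =
  pi^-1 * \int[mu]_(t in I) (phi t * Psi_tail psi beta n (x - t)).
Proof.
move=> phii fE n1.
have fN N y : (0 < N)%N -> f y - trig_poly a0 (fun k => pi^-1 * conv_cos phi k)
    (fun k => pi^-1 * conv_sin phi k) N y =
    pi^-1 * \int[mu]_(t in I) (phi t * Psi_tail psi beta N (y - t)).
  move=> N0; rewrite fE (conv_Psi_split y phii N0) /trig_poly.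
  under [X in _ - (_ + X)]eq_bigr do rewrite -!mulrA -mulrDr.
  by rewrite -mulr_sumr; ring.
rewrite (fourier_sum_uniform (c := a0) (p := fun k => pi^-1 * conv_cos phi k)
  (q := fun k => pi^-1 * conv_sin phi k)
  (e := fun N => (pi^-1 * \int[mu]_(t in I) `|phi t|) * \big[+%R/0]_(N <= k <oo) psi k)).
- by rewrite prednK// fN.
- rewrite -[X in _ --> X](mulr0 (pi^-1 * \int[mu]_(t in I) `|phi t|)).
  by apply: cvgM; [exact: cvg_cst|exact: sum_from_cvg0 psi_cvg].
- move=> N N0 t; rewrite fN// normrM gtr0_norm ?invr_gt0 ?pi_gt0//.
  rewrite -mulrA ler_wpM2l ?invr_ge0 ?pi_ge0// mulrC.
  apply: normr_integral_mul_le => //; first exact: measurable_Psi_tail.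
  by move=> s; have [_] := Psi_tail_le (t - s) N0; exact.
Qed.
End summable.
End kernel.

(** * Test functions close to differences of Dirac masses *)

Section bounds.
Context {R : realType}.
Local Notation mu := (@lebesgue_measure R).
Local Notation I := (`[- pi, pi]%classic : set R).
Local Notation P := (`[0, pi *+ 2[%classic : set R).

Lemma periodic_integral_window (f : R -> R) : periodic f (pi *+ 2) ->
  mu.-integrable P (EFin \o f) ->
  mu.-integrable I (EFin \o f) /\
  \int[mu]_(t in I) f t = \int[mu]_(t in P) f t.
Proof.
move=> fT; rewrite -[X in Interval _ (BLeft X)]add0r => fi.
have pi0 := pi_ge0 R.
have pT : pi <= 0 + pi *+ 2 :> R by rewrite add0r mulr2n lerDl.
have [fi' fE] := periodic_window pi0 pT fT fi.
rewrite [X in Interval (BLeft X)](_ : _ = - pi) in fi' fE; last first.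
  by rewrite mulr2n opprD addrA subrr add0r.
have/integrableP[mf boo] := fi'.
have mI : measurable_fun I (EFin \o f) by exact/emeasurable_fun_itv_bndo_bndcP.
split; last by rewrite -fE Rintegral_itv_bndo_bndc.
apply/integrableP; split => //.
by rewrite -integral_itv_bndo_bndc//; exact: measurableT_comp.
Qed.

Lemma L1_window (phi : R -> R) : L1 phi ->
  mu.-integrable I (EFin \o phi) /\ \int[mu]_(t in I) `|phi t| = L1_norm phi.
Proof.
move=> [phiT phii]; have [iI _] := periodic_integral_window phiT phii.
split=> //.
have nT : periodic (fun t => `|phi t|) (pi *+ 2) by move=> t; rewrite phiT.
have ni : mu.-integrable P (EFin \o (fun t => `|phi t|)) by exact: integrable_norm.
by have [_] := periodic_integral_window nT ni.
Qed.

(** An approximation of half the difference of the Dirac masses at u0 and u1, from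
    the right. *)
Definition bump (h u0 u1 t : R) : R :=
  (2 * h)^-1 * (\1_(`[u0, u0 + h[) t - \1_(`[u1, u1 + h[) t).

Lemma Rintegral_indicM (A D : set R) (g : R -> R) : measurable A ->
  A `<=` D -> \int[mu]_(t in D) (\1_A t * g t) = \int[mu]_(t in A) g t.
Proof.
move=> mA AD; rewrite -[in RHS](setIidr AD) Rintegral_mkcondr.
apply: eq_Rintegral => t _; rewrite /patch indicE.
by case: ifP => _; rewrite ?mul1r ?mul0r.
Qed.

Lemma measurable_bump h u0 u1 A : measurable_fun A (bump h u0 u1).
Proof.
apply: measurable_funM => //.
by apply: measurable_funB; exact: measurable_indic.
Qed.

Lemma indic_le1 (A : set R) t : `|\1_A t : R| <= 1.
Proof. by rewrite indicE; case: (_ \in _); rewrite ?normr1 ?normr0. Qed.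

Lemma integrable_indicM (A : set R) (g : R -> R) (M : R) : measurable A ->
  measurable_fun P g -> (forall t, `|g t| <= M) ->
  mu.-integrable P (EFin \o (fun t => \1_A t * g t)).
Proof.
move=> mA mg gM; apply: (@bounded_integrable _ _ M).
  by apply: measurable_funM => //; exact: measurable_indic.
move=> t; rewrite normrM (le_trans _ (gM t))// ler_piMl//; exact: indic_le1.
Qed.

Section bump.
Context (h u0 u1 : R).
Context (h01 : 0 < h <= 1).
Context (u0P : 0 <= u0 <= pi).
Context (u1P : 0 <= u1 <= pi).

Let h0 : 0 < h. Proof. by case/andP: h01. Qed.

Let hV0 : 0 <= (2 * h)^-1.
Proof. by rewrite invr_ge0 mulr_ge0// ltW. Qed.

Lemma bump_le t : `|bump h u0 u1 t| <= (2 * h)^-1 * (1 + 1).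
Proof.
rewrite /bump normrM ger0_norm// ler_wpM2l//.
by rewrite (le_trans (ler_normB _ _))// lerD ?indic_le1.
Qed.

Lemma sub_period u : 0 <= u <= pi -> `[u, u + h[ `<=` P.
Proof.
move=> /andP[u0' upi] t /=; rewrite !in_itv/= => /andP[ut tu].
rewrite (le_trans u0' ut)/= (lt_le_trans tu)// mulr2n lerD//.
have /andP[_ h1] := h01.
by rewrite (le_trans h1)// (le_trans _ (pi_ge2 R))// ler1n.
Qed.

Lemma measure_itv_h u : fine (mu `[u, u + h[) = h.
Proof.
rewrite lebesgue_measure_itv/= lte_fin ltrDl h0 -EFinB.
by rewrite addrAC subrr add0r.
Qed.

Lemma integral_bumpM (g : R -> R) (M : R) : measurable_fun P g ->
  (forall t, `|g t| <= M) ->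
  \int[mu]_(t in P) (bump h u0 u1 t * g t) =
  (2 * h)^-1 * (\int[mu]_(t in `[u0, u0 + h[) g t - \int[mu]_(t in `[u1, u1 + h[) g t).
Proof.
move=> mg gM.
have m0 : measurable `[u0, u0 + h[%classic by [].
have m1 : measurable `[u1, u1 + h[%classic by [].
have i0 := integrable_indicM m0 mg gM; have i1 := integrable_indicM m1 mg gM.
rewrite -(Rintegral_indicM g m0 (sub_period u0P)).
rewrite -(Rintegral_indicM g m1 (sub_period u1P)).
rewrite -RintegralB// -RintegralZl//; last first.
  exact: (@integrableB _ _ _ mu P _ (EFin \o _) (EFin \o _)).
by apply: eq_Rintegral => t _; rewrite /bump; ring.
Qed.

Lemma integral_bumpM_ge (g : R -> R) (M m0 m1 : R) : measurable_fun P g ->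
  (forall t, `|g t| <= M) ->
  (forall s, 0 <= s <= h -> m0 <= g (u0 + s)) ->
  (forall s, 0 <= s <= h -> g (u1 + s) <= m1) ->
  (m0 - m1) / 2 <= \int[mu]_(t in P) (bump h u0 u1 t * g t).
Proof.
move=> mg gM g0 g1; rewrite (integral_bumpM mg gM).
have gi : mu.-integrable P (EFin \o g) by exact: bounded_integrable gM.
have itvs u t : `[u, u + h[%classic t -> 0 <= t - u <= h.
  by rewrite /= in_itv/= subr_ge0 lerBlDl => /andP[-> /ltW ->].
have ci u r : 0 <= u <= pi -> mu.-integrable `[u, u + h[ (EFin \o (fun=> r)).
  move=> uP; apply: (@integrableS _ _ _ mu P) => //; first exact: sub_period.
  by apply: (@bounded_integrable _ _ `|r|).
have L0 : m0 * h <= \int[mu]_(t in `[u0, u0 + h[) g t.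
  have <- : \int[mu]_(t in `[u0, u0 + h[) m0 = m0 * h.
    by rewrite Rintegral_cst// [fine _]measure_itv_h.
  apply: le_Rintegral => //; first exact: ci.
    by apply: integrableS gi => //; exact: sub_period.
  by move=> t /itvs tu; rewrite -(subrKC u0 t); exact: g0.
have L1 : \int[mu]_(t in `[u1, u1 + h[) g t <= m1 * h.
  have <- : \int[mu]_(t in `[u1, u1 + h[) m1 = m1 * h.
    by rewrite Rintegral_cst// [fine _]measure_itv_h.
  apply: le_Rintegral => //; last 1 first.
  - by move=> t /itvs tu; rewrite -(subrKC u1 t); exact: g1.
  - by apply: integrableS gi => //; exact: sub_period.
  - exact: ci.
rewrite (_ : (m0 - m1) / 2 = (2 * h)^-1 * (m0 * h - m1 * h)); last first.
  by field; rewrite gt_eqF.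
by rewrite ler_wpM2l ?lerB.
Qed.

Definition periodize (f : R -> R) (t : R) : R :=
  f (t - (pi *+ 2) *~ Num.floor (t / (pi *+ 2))).

Lemma periodize_periodic f : periodic (periodize f) (pi *+ 2).
Proof.
move=> t; rewrite /periodize; congr f.
have p0 : (pi *+ 2 : R) != 0 by rewrite gt_eqF// mulrn_wgt0// pi_gt0.
rewrite mulrDl divff// floorDrz ?rpred1// floor1 mulrzDr mulr1z; ring.
Qed.

Lemma periodizeE f t : P t -> periodize f t = f t.
Proof.
rewrite /= in_itv/= => /andP[t0 tp]; rewrite /periodize.
have p0 : 0 < pi *+ 2 :> R by rewrite mulrn_wgt0// pi_gt0.
rewrite (_ : Num.floor _ = 0) ?mulr0z ?subr0//.
apply: floor_def; rewrite add0r mulr0z mulr1z.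
by rewrite divr_ge0 ?(ltW p0)//= ltr_pdivrMr// mul1r.
Qed.

(** The norm is bounded by the triangle inequality, so the two intervals may
    overlap, as happens when n is large compared with 1/h. *)
Lemma periodize_bump_B10 : B10 (periodize (bump h u0 u1)).
Proof.
set b := bump h u0 u1.
have bi : mu.-integrable P (EFin \o b).
  apply: (@bounded_integrable _ _ ((2 * h)^-1 * (1 + 1))).
    exact: measurable_bump.
  exact: bump_le.
have pbi : mu.-integrable P (EFin \o periodize b).
  apply: eq_integrable bi => //= t; rewrite inE => Pt.
  by rewrite /= periodizeE.
split; first by split => //; exact: periodize_periodic.
- rewrite /L1_norm.
  have Hi A : measurable A -> mu.-integrable P (EFin \o (fun t => \1_A t * (cst 1 t))).
    move=> mA; apply: (@integrable_indicM A (cst 1) 1) => // t.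
    by rewrite normr1.
  have m0 : measurable `[u0, u0 + h[%classic by [].
  have m1 : measurable `[u1, u1 + h[%classic by [].
  have <- : \int[mu]_(t in P) ((2 * h)^-1 *
      (\1_(`[u0, u0 + h[) t * (cst 1 t) + \1_(`[u1, u1 + h[) t * (cst 1 t))) = 1.
    rewrite RintegralZl//; last first.
      by apply: (@integrableD _ _ _ mu P _ (EFin \o _) (EFin \o _)) => //; exact: Hi.
    rewrite RintegralD//; try exact: Hi.
    rewrite (Rintegral_indicM _ m0 (sub_period u0P)).
    rewrite (Rintegral_indicM _ m1 (sub_period u1P)) /=.
    rewrite !Rintegral_cst// ![fine _]measure_itv_h.
    by field; rewrite gt_eqF.
  apply: le_Rintegral => //.
  - exact: integrable_norm.
  - apply: (@integrableZl _ _ _ mu P _ _ (EFin \o _)) => //.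
    by apply: (@integrableD _ _ _ mu P _ (EFin \o _) (EFin \o _)) => //; exact: Hi.
  - move=> t Pt; rewrite periodizeE// /b /bump normrM ger0_norm// ler_wpM2l//.
    rewrite (le_trans (ler_normB _ _))// /= !mulr1 lerD//;
      by rewrite ger0_norm// indicE ler0n.
- have [_ ->] := periodic_integral_window (periodize_periodic b) pbi.
  transitivity (\int[mu]_(t in P) (b t * cst 1 t)).
    by apply: eq_Rintegral => t; rewrite inE => Pt; rewrite periodizeE// mulr1.
  rewrite (@integral_bumpM _ 1)// => [|t]; last by rewrite normr1.
  by rewrite !Rintegral_cst// ![fine _]measure_itv_h subrr mulr0.
Qed.

Lemma integral_periodize_bumpM (g : R -> R) (M : R) : periodic g (pi *+ 2) ->
  measurable_fun [set: R] g -> (forall t, `|g t| <= M) ->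
  \int[mu]_(t in I) (periodize (bump h u0 u1) t * g t) =
  \int[mu]_(t in P) (bump h u0 u1 t * g t).
Proof.
move=> gT mg gM.
have E : {in P, (fun t => periodize (bump h u0 u1) t * g t) =1
    (fun t => bump h u0 u1 t * g t)}.
  by move=> t; rewrite inE => Pt; rewrite periodizeE.
transitivity (\int[mu]_(t in P) (periodize (bump h u0 u1) t * g t)); last first.
  exact: eq_Rintegral.
apply: (periodic_integral_window _ _).2.
  by move=> t; rewrite gT periodize_periodic.
apply: (@eq_integrable _ _ _ mu P _ (EFin \o (fun t => bump h u0 u1 t * g t))) => //.
  by move=> t Pt; rewrite /= E.
apply: (@bounded_integrable _ _ ((2 * h)^-1 * (1 + 1) * M)).
  by apply: measurable_funM; [exact: measurable_bump|exact: measurable_funTS].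
by move=> t; rewrite normrM ler_pM// bump_le.
Qed.
End bump.
End bounds.

(** * Behaviour of the kernel tail near the origin, and the two bounds *)

Section extremal.
Context {R : realType}.
Local Notation mu := (@lebesgue_measure R).
Local Notation I := (`[- pi, pi]%classic : set R).

Lemma cosD2piz (x : R) (m : int) : cos (x + (pi *+ 2) *~ m) = cos x.
Proof.
case: m => n; first by rewrite -pmulrn (periodicn (@cosD2pi R)).
by rewrite NegzE mulrNz -pmulrn -[LHS](periodicn (@cosD2pi R) n.+1) subrK.
Qed.

(** A first-order bound suffices because the remainder is linear in k - n. *)
Lemma cos_ge1B (x : R) : 1 - `|x| <= cos x.
Proof.
wlog x0 : x / 0 <= x.
  move=> H; have [/H//|/ltW x0] := leP 0 x.
  by rewrite -cosN -normrN; apply: H; rewrite oppr_ge0.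
have dcos (y : R) : y \in `]0, x[ -> is_derive y (1 : R) cos (- sin y).
  by move=> _; exact: is_derive_cos.
have [|c _ E] := MVT_segment x0 dcos.
  by apply: continuous_subspaceT; exact: continuous_cos.
rewrite ger0_norm//.
have -> : cos x = 1 - sin c * x by rewrite -(subrK (cos 0) (cos x)) E cos0; ring.
by rewrite lerD2l lerN2 ler_piMl// sin_le1.
Qed.

(** Reducing the phase to [-pi, pi] is what makes the constant independent of beta. *)
Lemma phase_mod2pi (b : R) : exists2 theta : R, - pi <= theta <= pi &
  forall y, cos (y - b) = cos (y - theta).
Proof.
have p0 : 0 < pi *+ 2 :> R by rewrite mulrn_wgt0// pi_gt0.
pose m := Num.floor ((b + pi) / (pi *+ 2)).
exists (b - (pi *+ 2) *~ m).
  have /andP[] := floor_itv ((b + pi) / (pi *+ 2)); rewrite -/m.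
  rewrite ler_pdivlMr// ltr_pdivrMr// intrD mulrDl mul1r.
  rewrite -mulrzl => l u; rewrite lerBrDl -lerBrDr; apply/andP; split; first lra.
  by move: u; rewrite mulr2n => u; lra.
by move=> y; rewrite opprB addrCA addrC cosD2piz addrC.
Qed.

Section tail_bounds.
Context (psi : nat -> R) (beta : R).
Context (psi_ge0 : forall k, (1 <= k)%N -> 0 <= psi k).
Context (kpsi_cvg : cvgn (fun N => \sum_(1 <= k < N) k%:R * psi k)).

Lemma psi_summable : cvgn (fun N => \sum_(1 <= k < N) psi k).
Proof.
apply: (sum_from_dominated _ kpsi_cvg).1 => k k1.
rewrite ger0_norm ?psi_ge0// ler_peMl ?psi_ge0//.
by rewrite ler1n.
Qed.

Lemma cvg_excess n : (1 <= n)%N ->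
  cvgn (fun N => \sum_(n <= k < N) ((k - n)%:R * psi k)).
Proof.
move=> n1.
have c : cvgn (fun N => \sum_(n <= k < N) (k%:R * psi k)).
  exact: cvg_sum_from kpsi_cvg.
apply: (sum_from_dominated _ c).1 => k nk.
have p0 := psi_ge0 (leq_trans n1 nk).
by rewrite ger0_norm ?mulr_ge0// ler_wpM2r// ler_nat leq_subr.
Qed.

Lemma Psi_tail_periodic n : periodic (Psi_tail psi beta n) (pi *+ 2).
Proof.
move=> t; rewrite /Psi_tail; congr (limn _); apply/funext => N.
apply: eq_bigr => k _; congr (_ * _).
rewrite -(cosD2piz (k%:R * t - beta * pi / 2) k); congr cos.
by rewrite -mulrzl /intmul; ring.
Qed.

(** Here e = 1 at a maximum and e = -1 at a minimum of the n-th harmonic.  The phase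
    of the k-th harmonic at tau - s is that of the n-th one at tau plus
    (k - n) tau - k s, so up to the sign e each harmonic is the cosine of an angle of
    modulus at most (k - n) pi/n + k h. *)
Lemma Psi_tail_near_peak (n : nat) (theta tau e s h : R) : (1 <= n)%N -> e = 1 \/ e = -1 ->
  (forall y, cos (y - beta * pi / 2) = cos (y - theta)) ->
  (forall y, cos (y + n%:R * tau - theta) = e * cos y) ->
  `|tau| <= pi / n%:R -> 0 <= s <= h ->
  \big[+%R/0]_(n <= k <oo) psi k
    - (pi / n%:R * \big[+%R/0]_(n <= k <oo) ((k - n)%:R * psi k)
       + h * \big[+%R/0]_(n <= k <oo) (k%:R * psi k))
  <= e * Psi_tail psi beta n (tau - s).
Proof.
move=> n1 e1 thE tauE tau_le /andP[s0 sh].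
have c1 : cvgn (fun N => \sum_(n <= k < N) psi k) by exact: cvg_sum_from psi_summable.
have c3 : cvgn (fun N => \sum_(n <= k < N) (k%:R * psi k)).
  exact: cvg_sum_from kpsi_cvg.
have c2 := cvg_excess n1.
have [c4 _] := Psi_tail_le beta psi_ge0 psi_summable (tau - s) n1.
have [c5 E5] := sum_from_lincomb (- (pi / n%:R)) c1 c2.
have [c6 E6] := sum_from_lincomb (- h) c5 c3.
have c0 : cvgn (fun N => \sum_(n <= k < N) (0 : R)).
  by under eq_fun do rewrite big1//; exact: is_cvg_cst.
have [c7 E7] := sum_from_lincomb e c0 c4.
have E0 : \big[+%R/0]_(n <= k <oo) (0 : R) = 0.
  by apply/cvg_lim => //; under eq_fun do rewrite big1//; exact: cvg_cst.
rewrite E0 add0r in E7.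
rewrite -[leRHS]E7 opprD addrA -[X in _ + X - _]mulNr -E5 -[X in _ + X <= _]mulNr -E6.
apply: le_sum_from => // k nk; rewrite add0r.
have p0 := psi_ge0 (leq_trans n1 nk).
rewrite thE.
rewrite (_ : k%:R * (tau - s) - theta =
  ((k - n)%:R * tau - k%:R * s) + n%:R * tau - theta); last first.
  by rewrite natrB//; ring.
rewrite tauE.
rewrite (_ : e * _ = psi k * cos ((k - n)%:R * tau - k%:R * s)); last first.
  by case: e1 => ->; ring.
have := cos_ge1B ((k - n)%:R * tau - k%:R * s).
have : `|(k - n)%:R * tau - k%:R * s| <= (k - n)%:R * (pi / n%:R) + k%:R * h.
  apply: le_trans (ler_normB _ _) _; rewrite !normrM !normr_nat (ger0_norm s0).
  by rewrite lerD// ler_wpM2l.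
move=> H1 H2; have H3 : 1 - ((k - n)%:R * (pi / n%:R) + k%:R * h) <=
  cos ((k - n)%:R * tau - k%:R * s) by apply: le_trans H2; rewrite lerD2l lerN2.
apply: le_trans (ler_wpM2l p0 H3).
by rewrite le_eqVlt; apply/orP; left; apply/eqP; ring.
Qed.

(** With theta the reduced phase, t0 = theta/n is a maximum of the n-th harmonic and
    t1 is the adjacent minimum on the side of the origin, so that both stay within
    pi/n of it.  The masses sit at 0 and pi/n, in the order that makes x - u0 = t0
    and x - u1 = t1 for a common x. *)
Lemma antipodal_points (n : nat) : (1 <= n)%N -> exists theta t0 t1 x u0 u1 : R,
  [/\ forall y, cos (y - beta * pi / 2) = cos (y - theta),
      (forall y, cos (y + n%:R * t0 - theta) = 1 * cos y) /\ `|t0| <= pi / n%:R,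
      (forall y, cos (y + n%:R * t1 - theta) = -1 * cos y) /\ `|t1| <= pi / n%:R,
      x - u0 = t0 /\ x - u1 = t1 &
      0 <= u0 <= pi /\ 0 <= u1 <= pi].
Proof.
move=> n1; have [theta th_le thE] := phase_mod2pi (beta * pi / 2).
have n0 : 0 < n%:R :> R by rewrite ltr0n.
have nn0 : n%:R != 0 :> R by rewrite gt_eqF.
have pin : 0 <= (pi / n%:R : R) <= pi.
  rewrite divr_ge0 ?pi_ge0 ?ler0n//= ler_pdivrMr// ler_peMr ?pi_ge0//.
  by rewrite ler1n.
have p0 : 0 <= (pi : R) <= pi by rewrite pi_ge0 lexx.
have /andP[th1 th2] := th_le.
have t0E y : cos (y + n%:R * (theta / n%:R) - theta) = 1 * cos y.
  by rewrite mul1r; congr cos; field.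
have t0_le : `|theta / n%:R| <= pi / n%:R.
  by rewrite normrM [X in _ * X]ger0_norm ?invr_ge0 ?ler0n// ler_wpM2r ?invr_ge0 ?ler0n// ler_norml th_le.
have [th0|th0] := leP 0 theta.
- exists theta, (theta / n%:R), ((theta - pi) / n%:R), (theta / n%:R), 0, (pi / n%:R).
  split => //.
  + split.
      move=> y.
      rewrite (_ : _ - theta = y - pi); last by field.
      by rewrite -[y in RHS](subrK pi) cosDpi; ring.
    rewrite normrM [X in _ * X]ger0_norm ?invr_ge0 ?ler0n//.
    by rewrite ler_wpM2r ?invr_ge0 ?ler0n// ler_norml; lra.
  + by split; [rewrite subr0|rewrite -mulrBl].
  + by split => //; rewrite lexx pi_ge0.
- exists theta, (theta / n%:R), ((theta + pi) / n%:R), ((theta + pi) / n%:R), (pi / n%:R), 0.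
  split => //.
  + split.
      move=> y; rewrite (_ : _ - theta = y + pi); last by field.
      by rewrite cosDpi; ring.
    rewrite normrM [X in _ * X]ger0_norm ?invr_ge0 ?ler0n//.
    by rewrite ler_wpM2r ?invr_ge0 ?ler0n// ler_norml; lra.
  + by split; [rewrite -mulrBl addrK|rewrite subr0].
  + by split => //; rewrite lexx pi_ge0.
Qed.

Lemma E_n_le n : (1 <= n)%N ->
  (E_n psi beta n <= (pi^-1 * \big[+%R/0%R]_(n <= k <oo) psi k)%:E)%E.
Proof.
move=> n1; apply: ge_ereal_sup => _ [f [a0 [phi phiB fE]] <-].
apply: ge_ereal_sup => _ [x _ <-]; rewrite lee_fin.
have [phiL phi1 _] := phiB; have [phii phiN] := L1_window phiL.
rewrite (deviation_integral psi_ge0 psi_summable _ phii fE n1).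
rewrite normrM gtr0_norm ?invr_gt0 ?pi_gt0// ler_wpM2l ?invr_ge0 ?pi_ge0//.
apply: (@le_trans _ _ (\big[+%R/0]_(n <= k <oo) psi k * \int[mu]_(t in I) `|phi t|)).
  apply: normr_integral_mul_le => //.
    exact: (measurable_Psi_tail beta psi_ge0 psi_summable).
  by move=> t; exact: (Psi_tail_le beta psi_ge0 psi_summable _ n1).2.
rewrite phiN ler_piMr//.
exact: le_trans (Psi_tail_le beta psi_ge0 psi_summable 0 n1).2.
Qed.

Lemma E_n_ge n h : (1 <= n)%N -> 0 < h <= 1 ->
  ((pi^-1 * (\big[+%R/0]_(n <= k <oo) psi k
    - (pi / n%:R * \big[+%R/0]_(n <= k <oo) ((k - n)%:R * psi k)
       + h * \big[+%R/0]_(n <= k <oo) (k%:R * psi k))))%:E <= E_n psi beta n)%E.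
Proof.
move=> n1 h01; set m := (X in pi^-1 * X).
have [theta [t0 [t1 [x [u0 [u1]]]]]] := antipodal_points n1.
move=> [thE [t0E t0_le] [t1E t1_le] [xu0 xu1] [u0P u1P]].
(* At this x the convolution samples the kernel tail just to the left of t0 and t1. *)
pose phi := periodize (bump h u0 u1).
have phiB : B10 phi by exact: periodize_bump_B10.
pose f y := 0 / 2 + pi^-1 * \int[mu]_(t in I) (phi t * Psi psi beta (y - t)).
have fC : Cpsi psi beta f by exists 0, phi.
have [phiL _ _] := phiB; have [phii _] := L1_window phiL.
apply: (@le_trans _ _ (C_norm (fun y => f y - fourier_sum f n.-1 y))); last first.
  by apply: ereal_sup_ubound; exists f.
apply: (@le_trans _ _ (`|f x - fourier_sum f n.-1 x|)%:E); last first.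
  by apply: ereal_sup_ubound; exists x.
rewrite lee_fin (le_trans _ (ler_norm _))//.
rewrite (deviation_integral psi_ge0 psi_summable x phii (fun=> erefl) n1).
rewrite ler_wpM2l ?invr_ge0 ?pi_ge0//.
have gM t := (Psi_tail_le beta psi_ge0 psi_summable (x - t) n1).2.
have mg A := @measurable_Psi_tail _ _ beta psi_ge0 psi_summable n A x n1.
have gT : periodic (fun t => Psi_tail psi beta n (x - t)) (pi *+ 2).
  move=> t; rewrite -[in LHS]Psi_tail_periodic; congr Psi_tail; ring.
rewrite /phi (integral_periodize_bumpM u0 u1 h01 gT (mg _) gM).
(* The kernel tail is at least m near t0 and at most - m near t1. *)
have -> : m = (m - - m) / 2 by field.
apply: (integral_bumpM_ge h01 u0P u1P (mg _) gM) => s sh.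
- rewrite opprD addrA xu0 -[leRHS]mul1r.
  by apply: (Psi_tail_near_peak n1 _ thE t0E t0_le sh); left.
- rewrite opprD addrA xu1 -[leLHS]opprK -[X in - X <= _]mulN1r lerN2.
  by apply: (Psi_tail_near_peak n1 _ thE t1E t1_le sh); right.
Qed.
End tail_bounds.
End extremal.

Theorem theorem2p1 (R : realType) :
  exists K : R, 0 < K /\
    forall (psi : nat -> R) (beta : R) (n : nat),
      (forall k, (1 <= k)%N -> 0 <= psi k) ->
      cvgn (fun N => \sum_(1 <= k < N) k%:R * psi k) ->
      (1 <= n)%N ->
      (`| E_n psi beta n - (pi^-1 * \big[+%R/0%R]_(n <= k <oo) psi k)%:E |
       <= (K / n%:R * \big[+%R/0%R]_(1 <= k <oo) (k%:R * psi (k + n)%N))%:E)%E.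
Proof.
exists 1; split => // psi beta n psi_ge0 kpsi_cvg n1.
have c3 : cvgn (fun N => \sum_(n <= k < N) (k%:R * psi k)).
  exact: cvg_sum_from kpsi_cvg.
have c2 := cvg_excess psi_ge0 kpsi_cvg n1.
rewrite (sum_from_shift c2).
have le_E := E_n_le beta psi_ge0 kpsi_cvg n1.
have ge_E h := @E_n_ge _ _ beta psi_ge0 kpsi_cvg n h n1.
set T := \big[+%R/0]_(n <= k <oo) psi k in le_E ge_E *.
set J := \big[+%R/0]_(n <= k <oo) ((k - n)%:R * psi k) in ge_E *.
set L := \big[+%R/0]_(n <= k <oo) (k%:R * psi k) in ge_E.
have L0 : 0 <= L.
  have := (sum_from_dominated (m := n) (a := fun k => k%:R * psi k) _ c3).2.
  move=> H; apply: le_trans (normr_ge0 _) (H _) => k nk.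
  by rewrite ger0_norm// mulr_ge0// psi_ge0// (leq_trans n1 nk).
have pi0 : 0 < pi :> R by exact: pi_gt0.
have pin0 : pi != 0 :> R by rewrite gt_eqF.
have nn0 : n%:R != 0 :> R by rewrite pnatr_eq0 -lt0n.
(* Both bounds are real numbers, hence so is E_n. *)
have := ge_E 1; rewrite ltr01 lexx => /(_ isT).
case: (E_n psi beta n) le_E ge_E => [r| |]//.
rewrite lee_fin => r_le r_ge _.
rewrite -EFinB /= lee_fin ler0_norm ?subr_le0// opprB.
apply/ler_addgt0Pr => e e0.
have L1 : 0 < L + 1 by rewrite ltr_wpDl.
(* The width is at most 1 < pi so that the bumps fit in one period, and small enough
   for the cost h * L of spreading the masses to be at most e. *)
pose h := Num.min 1 (e / (L + 1)).
have h0 : 0 < h by rewrite lt_min ltr01 divr_gt0.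
have h1 : h <= 1 by rewrite ge_min lexx.
have hL : h * L <= e.
  apply: (@le_trans _ _ (e / (L + 1) * (L + 1))); last by rewrite divfK// gt_eqF.
  by apply: ler_pM => //; [exact: ltW|rewrite ge_min lexx orbT|rewrite lerDl].
have := r_ge h; rewrite h0 h1 => /(_ isT); rewrite lee_fin => r_ge'.
have E : pi^-1 * (T - (pi / n%:R * J + h * L)) = pi^-1 * T - 1 / n%:R * J - pi^-1 * (h * L).
  by move: pi pin0 => P P0; field; rewrite ?nn0 ?P0.
rewrite E in r_ge'.
have : pi^-1 * (h * L) <= e.
  apply: le_trans hL; rewrite ler_piMl ?mulr_ge0 ?(ltW h0)//.
  by rewrite invf_le1// (le_trans _ (pi_ge2 R))// ler1n.
by move: r_ge'; set A := pi^-1 * (h * L); set B := pi^-1 * T; set C := 1 / _ * J; lra.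
Qed.
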